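(* Let $f:\mathbb{R}^n\to\mathbb{R}$ be $L$-smooth and $\mu$-strongly convex with $\mu>0$, and let $\mathcal{P}\subseteq\mathbb{R}^{n\times n}$ be a closed convex set with $0\in\mathcal{P}$, $L^{-1}I\in\mathcal{P}$ and $\mathrm{diam}(\mathcal{P})\le D$, where $D>0$. Let $K\ge 1$, $x^1\in\mathbb{R}^n$, $P_1\in\mathcal{P}$, and let $\{x^k\},\{P_k\}$ be generated by OSGM-R with stepsize $\eta=\min\big\{\tfrac{1}{4L^2},\tfrac{D}{2L(1+LD)\sqrt{K}}\big\}$. Assume $x^1,\dots,x^K$ are not minimizers of $f$. Then $$f(x^{K+1})-f(x^\star)\le (f(x^1)-f(x^\star))\Big(\theta_K^\star+\frac{\rho_K}{K}\Big)^K,$$ where $\theta_K^\star:=\min_{P\in\mathcal{P}}\frac1K\sum_{k=1}^K r_{x^k}(P)$ and $\rho_K:=\max\big\{4LD(1+LD)\sqrt{K},\,8L^2D^2\big\}$.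
   Context: Norms: $\|\cdot\|$ is the Euclidean norm of vectors and the spectral norm of matrices; $\|\cdot\|_F$ is the Frobenius norm; $\mathrm{diam}(\mathcal{P})=\sup_{P,Q\in\mathcal{P}}\|P-Q\|_F$. Assumptions on $f$: $f$ is twice differentiable; $L$-smooth means $|f(x)-f(y)-\langle\nabla f(y),x-y\rangle|\le\frac L2\|x-y\|^2$ for all $x,y$; $\mu$-strongly convex means $f(x)-f(y)-\langle\nabla f(y),x-y\rangle\ge\frac\mu2\|x-y\|^2$ for all $x,y$. $x^\star$ is the minimizer of $f$. Ratio surrogate: for $x$ not a minimizer and $P\in\mathbb{R}^{n\times n}$, $r_x(P):=\dfrac{f(x-P\nabla f(x))-f(x^\star)}{f(x)-f(x^\star)}$. Its gradient in $P$ is $\nabla r_x(P)=-\dfrac{\nabla f(x-P\nabla f(x))\nabla f(x)^\top}{f(x)-f(x^\star)}$. OSGM-R: for $k=1,2,\dots$: $x^{k+1}=x^k-P_k\nabla f(x^k)$ and $P_{k+1}=\Pi_{\mathcal{P}}[P_k-\eta\nabla r_{x^k}(P_k)]$, where $\Pi_{\mathcal{P}}$ is the orthogonal projection onto $\mathcal{P}$ (with respect to the Frobenius inner product). *)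

(* Defs.v *)
From HB Require Import structures.
From mathcomp Require Import all_boot all_order all_algebra.
From mathcomp Require Import all_classical all_reals all_analysis.

Set Implicit Arguments.
Unset Strict Implicit.
Unset Printing Implicit Defensive.

Import Order.TTheory GRing.Theory Num.Theory.
Import numFieldNormedType.Exports.

Local Open Scope classical_set_scope.
Local Open Scope ring_scope.

(* Frobenius inner product and norm; on 'cV[R]_n = 'M[R]_(n, 1) they are the
   Euclidean ones. They are needed because the library norm `|A| on matrices is
   the max norm; it induces the same topology and differentiability. *)
Definition dotp {R : realType} {m n : nat} (A B : 'M[R]_(m, n)) : R :=
  \sum_i \sum_j A i j * B i j.

Definition fnorm {R : realType} {m n : nat} (A : 'M[R]_(m, n)) : R :=
  Num.sqrt (dotp A A).

(* The matrix of partial derivatives: the gradient w.r.t. dotp wherever h is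
   differentiable. Used both for functions of vectors and of matrices. *)
Definition grad {R : realType} {m n : nat} (h : 'M[R]_(m, n) -> R)
    (X : 'M[R]_(m, n)) : 'M[R]_(m, n) :=
  \matrix_(i, j) 'D_(delta_mx i j) h X.

Section ObjectiveFunction.
Context {R : realType} {n : nat}.
Implicit Type f : 'cV[R]_n -> R.

Definition twice_differentiable f : Prop :=
  (forall x, differentiable f x) /\ (forall x, differentiable (grad f) x).

Definition smooth (L : R) f : Prop :=
  forall x y,
    `|f x - f y - dotp (grad f y) (x - y)| <= L / 2 * fnorm (x - y) ^+ 2.

Definition strongly_convex (mu : R) f : Prop :=
  forall x y,
    mu / 2 * fnorm (x - y) ^+ 2 <= f x - f y - dotp (grad f y) (x - y).

Definition is_minimizer f (x : 'cV[R]_n) : Prop := forall y, f x <= f y.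

End ObjectiveFunction.

(* Extended-real valued, so that diam S <= D%:E does force S to be bounded (the
   real-valued sup of an unbounded set is 0). *)
Definition diam {R : realType} {m n : nat} (S : set 'M[R]_(m, n)) : \bar R :=
  ereal_sup [set (fnorm (PQ.1 - PQ.2))%:E | PQ in S `*` S].

Definition is_projection {R : realType} {m n : nat} (S : set 'M[R]_(m, n))
    (Z Q : 'M[R]_(m, n)) : Prop :=
  S Q /\ forall Q', S Q' -> fnorm (Z - Q) <= fnorm (Z - Q').

Definition is_min {R : realType} (E : set R) (t : R) : Prop :=
  E t /\ lbound E t.

Section OSGMR.
Context {R : realType} {n : nat}.
Variables (f : 'cV[R]_n -> R) (xstar : 'cV[R]_n).

Definition ratio (x : 'cV[R]_n) (P : 'M[R]_n) : R :=
  (f (x - P *m grad f x) - f xstar) / (f x - f xstar).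

(* The first K iterations, with indices starting at 1: the values x 0 and P 0
   are irrelevant. *)
Definition osgm_r (calP : set 'M[R]_n) (eta : R) (K : nat)
    (x : nat -> 'cV[R]_n) (P : nat -> 'M[R]_n) : Prop :=
  forall k, (1 <= k <= K)%N ->
    x k.+1 = x k - P k *m grad f (x k) /\
    is_projection calP (P k - eta *: grad (ratio (x k)) (P k)) (P k.+1).

Definition avg_ratio (K : nat) (x : nat -> 'cV[R]_n) (P : 'M[R]_n) : R :=
  K%:R^-1 * \sum_(1 <= k < K.+1) ratio (x k) P.

End OSGMR.

Definition stepsize {R : realType} (L D : R) (K : nat) : R :=
  Num.min (1 / (4 * L ^+ 2)) (D / (2 * L * (1 + L * D) * Num.sqrt K%:R)).

Definition rho {R : realType} (L D : R) (K : nat) : R :=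
  Num.max (4 * L * D * (1 + L * D) * Num.sqrt K%:R) (8 * L ^+ 2 * D ^+ 2).

(* Main.v *)
Require Import Defs.
From HB Require Import structures.
From mathcomp Require Import all_boot all_order all_algebra.
From mathcomp Require Import all_classical all_reals all_analysis.
From mathcomp Require Import ring lra.

Set Implicit Arguments.
Unset Strict Implicit.
Unset Printing Implicit Defensive.

Import Order.TTheory GRing.Theory Num.Theory.
Import numFieldNormedType.Exports.

Local Open Scope classical_set_scope.
Local Open Scope ring_scope.

(* With a_k = f(x^k) - min f, the update gives a_{k+1} = r_k(P_k) a_k, so by
   AM-GM it suffices to bound the average of the r_k(P_k), i.e. the regret of
   projected gradient descent on the convex functions r_k. Descent along the
   gradient gives |grad f|^2 <= 2L (f - min f), hence
   |grad r_k(P)|^2 <= 4 L^2 r_k(P), while smoothness along P grad f gives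
   r_k(P) <= (1 + LD)^2 on the feasible set. The regret is thus at most
   D^2 / (2 eta) + 2 eta L^2 (1 + LD)^2 K, and each of the two terms is at most
   rho_K / 4. *)

(** * Frobenius geometry: Cauchy-Schwarz and projection onto a convex set *)

Section FrobeniusInnerProduct.
Context {R : realType} {m n : nat}.
Implicit Types (A B C : 'M[R]_(m, n)) (S : set 'M[R]_(m, n)).

Lemma dotpC A B : dotp A B = dotp B A.
Proof. by do 2!apply: eq_bigr => ? _; rewrite mulrC. Qed.

Lemma dotpDr A B C : dotp A (B + C) = dotp A B + dotp A C.
Proof.
rewrite -big_split; apply: eq_bigr => i _; rewrite -big_split /=.
by apply: eq_bigr => j _; rewrite mxE mulrDr.
Qed.

Lemma dotpZr A (c : R) B : dotp A (c *: B) = c * dotp A B.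
Proof.
rewrite /dotp big_distrr; apply: eq_bigr => i _; rewrite big_distrr /=.
by apply: eq_bigr => j _; rewrite mxE; ring.
Qed.

Lemma dotpNr A B : dotp A (- B) = - dotp A B.
Proof. by rewrite -scaleN1r dotpZr mulN1r. Qed.

Lemma dotpBr A B C : dotp A (B - C) = dotp A B - dotp A C.
Proof. by rewrite dotpDr dotpNr. Qed.

Lemma dotpDl A B C : dotp (A + B) C = dotp A C + dotp B C.
Proof. by rewrite dotpC dotpDr !(dotpC C). Qed.

Lemma dotpZl A (c : R) B : dotp (c *: A) B = c * dotp A B.
Proof. by rewrite dotpC dotpZr dotpC. Qed.

Lemma dotpNl A B : dotp (- A) B = - dotp A B.
Proof. by rewrite dotpC dotpNr dotpC. Qed.

Lemma dotpBl A B C : dotp (A - B) C = dotp A C - dotp B C.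
Proof. by rewrite dotpDl dotpNl. Qed.

Lemma dotp_ge0 A : 0 <= dotp A A.
Proof. by do 2!apply: sumr_ge0 => ? _; exact: sqr_ge0. Qed.

Lemma fnorm_sqr A : fnorm A ^+ 2 = dotp A A.
Proof. by rewrite sqr_sqrtr ?dotp_ge0. Qed.

Lemma fnorm_ge0 A : 0 <= fnorm A.
Proof. exact: sqrtr_ge0. Qed.

Lemma dotp_sub A B :
  dotp (A - B) (A - B) = dotp A A - 2 * dotp A B + dotp B B.
Proof. by rewrite dotpBl !dotpBr (dotpC B A); ring. Qed.

Lemma dotp_cauchy_schwarz A B : dotp A B ^+ 2 <= dotp A A * dotp B B.
Proof.
have := dotp_ge0 A; have := dotp_ge0 B; rewrite !le0r.
have half C E : 0 < dotp C C -> dotp C E ^+ 2 <= dotp C C * dotp E E.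
  move=> C_gt0; have := dotp_ge0 (dotp C C *: E - dotp C E *: C).
  rewrite dotp_sub !dotpZl !dotpZr (dotpC E C).
  rewrite [leRHS](_ : _ = dotp C C * (dotp C C * dotp E E - dotp C E ^+ 2));
    last by ring.
  by rewrite pmulr_rge0 // subr_ge0.
move=> /predU1P[B0|B_gt0]; last first.
  by rewrite dotpC mulrC => _; exact: half.
move=> /predU1P[A0|]; last exact: half.
(* With both squared norms zero, this squared norm expands to [- 2 * dotp A B ^+ 2], so its
   nonnegativity forces [dotp A B = 0]. *)
have := dotp_ge0 (A - dotp A B *: B).
by rewrite dotp_sub dotpZr dotpZl dotpZr A0 B0; nra.
Qed.

Lemma norm_dotp_le A B : `|dotp A B| <= fnorm A * fnorm B.
Proof.
rewrite -(@ler_pXn2r _ 2) ?nnegrE ?mulr_ge0 ?fnorm_ge0 //.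
by rewrite real_normK ?num_real // exprMn !fnorm_sqr dotp_cauchy_schwarz.
Qed.

Lemma norm_coord_le A i j : `|A i j| <= fnorm A.
Proof.
rewrite -(@ler_pXn2r _ 2) ?nnegrE ?fnorm_ge0 //.
rewrite real_normK ?num_real // fnorm_sqr /dotp (bigD1 i) //= (bigD1 j) //=.
rewrite -expr2 -addrA lerDl addr_ge0 ?sumr_ge0 // => *; first exact: sqr_ge0.
by apply: sumr_ge0 => *; exact: sqr_ge0.
Qed.

Lemma diam_ge S (d : R) A B :
  (diam S <= d%:E)%E -> S A -> S B -> fnorm (A - B) <= d.
Proof.
move=> Sd SA SB; rewrite -lee_fin; apply: le_trans Sd.
by apply: ereal_sup_ubound; exists (A, B).
Qed.

(** Comparing [B] with nearby points of the segment towards [C] shows that [A - B] and [C - B] form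
    no acute angle. Expanding the square of [(A - B) - (C - B)] then gives the bound. *)
Lemma projection_nonexpansive S A B C :
  convex_set S -> is_projection S A B -> S C ->
  dotp (B - C) (B - C) <= dotp (A - C) (A - C).
Proof.
move=> S_convex [SB B_min] SC.
have segment t : 0 < t -> t <= 1 ->
    2 * dotp (A - B) (C - B) <= t * dotp (C - B) (C - B).
  move=> t0 t1.
  have t01 : Itv.spec (@Itv.num_sem R) (Itv.Real `[0%Z, 1%Z]) t.
    by rewrite /= /Itv.num_sem /= num_real /= in_itv /= ltW.
  pose lam : {i01 R} := Itv.mk t01.
  have /set_mem SE : conv lam (C : convex_lmodType _) B \in S.
    by apply: S_convex; exact: mem_set.
  have E : conv lam (C : convex_lmodType _) B = B + t *: (C - B).
    change (t *: C + (1 - t) *: B = B + t *: (C - B)).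
    by rewrite scalerBl scale1r scalerBr addrCA.
  have := B_min _ SE; rewrite E /fnorm ler_sqrt ?dotp_ge0 // opprD addrA.
  rewrite [dotp (_ - _ - _) _]dotp_sub dotpZl !dotpZr => H.
  have {H} : 0 <= t * (t * dotp (C - B) (C - B) - 2 * dotp (A - B) (C - B)).
    by lra.
  by rewrite pmulr_rge0 // subr_ge0.
have acute : dotp (A - B) (C - B) <= 0.
  rewrite leNgt; apply/negP => pos.
  set c := dotp (C - B) (C - B) in segment.
  have c_ge0 : 0 <= c := dotp_ge0 _.
  set p := dotp (A - B) (C - B) in segment pos.
  (* This [t] lies in (0, 1] even if [c = 0], and turns [segment] into [2 * p * (c + p) <= p * c],
     impossible for [p > 0]. *)
  have := segment (p / (c + p)); rewrite divr_gt0 ?ler_pdivrMr; try lra.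
  move=> /(_ isT); rewrite mul1r lerDr => /(_ c_ge0).
  rewrite mulrAC ler_pdivlMr; nra.
rewrite (_ : A - C = (A - B) - (C - B)); last by rewrite opprB addrA subrK.
rewrite [leRHS]dotp_sub -[B - C]opprB dotpNl dotpNr opprK.
have := dotp_ge0 (A - B); lra.
Qed.

End FrobeniusInnerProduct.

(** * Rank-one matrices and bounds on matrix-vector products *)

Lemma dotp_mulmx_col {R : realType} {m n : nat} (u : 'cV[R]_m)
    (A : 'M[R]_(m, n)) (v : 'cV[R]_n) : dotp u (A *m v) = dotp (u *m v^T) A.
Proof.
apply: eq_bigr => i _; rewrite big_ord1 mxE big_distrr /=.
by apply: eq_bigr => j _; rewrite mxE big_ord1 mxE; ring.
Qed.

Lemma dotp_outer {R : realType} {m n : nat} (u : 'cV[R]_m) (v : 'cV[R]_n) :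
  dotp (u *m v^T) (u *m v^T) = dotp u u * dotp v v.
Proof.
rewrite -dotp_mulmx_col -mulmxA.
rewrite (_ : v^T *m v = (dotp v v)%:M) ?mul_mx_scalar ?dotpZr 1?mulrC //.
apply/matrixP => i j; rewrite !ord1 !mxE eqxx mulr1n.
by apply: eq_bigr => k _; rewrite big_ord1 mxE.
Qed.

Lemma norm_dotp_mulmx_le {R : realType} {m n : nat} (u : 'cV[R]_m)
    (A : 'M[R]_(m, n)) (v : 'cV[R]_n) :
  `|dotp u (A *m v)| <= fnorm u * fnorm v * fnorm A.
Proof.
rewrite dotp_mulmx_col (le_trans (norm_dotp_le _ _)) //.
by rewrite {1}/fnorm dotp_outer sqrtrM ?dotp_ge0.
Qed.

(** Take [u = A *m v] in the previous bound and cancel one factor [fnorm (A *m v)], the zero case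
    being trivial. *)
Lemma fnorm_mulmx_le {R : realType} {m n : nat} (A : 'M[R]_(m, n))
    (v : 'cV[R]_n) : fnorm (A *m v) <= fnorm A * fnorm v.
Proof.
have [w0|w_gt0] := leP (fnorm (A *m v)) 0.
  by rewrite (le_trans w0) // mulr_ge0 ?fnorm_ge0.
rewrite -(ler_pM2l w_gt0) -expr2 fnorm_sqr.
apply: le_trans (ler_norm _) _; apply: le_trans (norm_dotp_mulmx_le _ _ _) _.
by rewrite -mulrA [fnorm v * _]mulrC.
Qed.

(** * Continuity and compactness for matrices *)

Lemma continuous_mx {R : realType} {T : topologicalType} (m n : nat)
    (g : T -> 'M[R]_(m, n)) :
  (forall i j, continuous (fun t => g t i j)) -> continuous g.
Proof.
move=> g_continuous t B [C C_nbhs CB].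
suff near_C : \forall s \near t, forall i j, C i j (g s i j).
  by apply: filterS near_C => s; exact: CB.
apply: filter_forall => i; apply: filter_forall => j.
exact: g_continuous (C_nbhs i j).
Qed.

(** Heine-Borel transported from row vectors: [A] is a closed subset of the image under [vec_mx] of
    the cube of side [[- c, c]], since entries are bounded by the Frobenius norm. *)
Lemma matrix_bounded_closed_compact {R : realType} (m n : nat)
    (A : set 'M[R]_(m, n)) (c : R) :
  (forall Q, A Q -> fnorm Q <= c) -> closed A -> compact A.
Proof.
move=> A_bounded A_closed.
have vec_mx_continuous : continuous (vec_mx : 'rV[R]_(m * n) -> 'M[R]_(m, n)).
  apply: continuous_mx => i j v; under eq_fun do rewrite mxE.
  exact: coord_continuous.
pose box := [set w : 'rV[R]_(m * n) | forall k, `[- c, c]%classic (w ord0 k)].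
have box_compact : compact box.
  by apply: (@rV_compact _ _ (fun=> _)) => _; exact: segment_compact.
apply: (subclosed_compact A_closed
  (continuous_compact (continuous_subspaceT vec_mx_continuous) box_compact)).
move=> Q AQ; exists (mxvec Q); last by rewrite mxvecK.
move=> k; case/mxvec_indexP: k => i j; rewrite /= mxvecE in_itv /= -ler_norml.
exact: le_trans (norm_coord_le _ _ _) (A_bounded _ AQ).
Qed.

Lemma mulmxl_continuous {R : realType} (m n p : nat) (v : 'M[R]_(n, p)) :
  continuous (fun Q : 'M[R]_(m, n) => Q *m v).
Proof.
apply: continuous_mx => i j; under eq_fun do rewrite mxE.
apply: continuous_big => [|k _ S]; first exact: add_continuous.
exact: (cvgMr_tmp (@coord_continuous R m n i k S)).
Qed.

(** * The ratio surrogate: gradient, continuity, attained minimum *)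

Section Objective.
Context {R : realType} {n : nat} (f : 'cV[R]_n -> R) (xstar : 'cV[R]_n).
Hypothesis f_differentiable : forall x, differentiable f x.
Implicit Types (x y : 'cV[R]_n) (Q : 'M[R]_n).

Lemma derive_dotp_grad x v : 'D_v f x = dotp (grad f x) v.
Proof.
rewrite deriveE // [in LHS](matrix_sum_delta v) raddf_sum /=.
apply: eq_bigr => i _; rewrite raddf_sum /=; apply: eq_bigr => j _.
by rewrite linearZ /= mxE deriveE // mulrC.
Qed.

Lemma grad_ratio x Q : grad (Defs.ratio f xstar x) Q =
  - ((f x - f xstar)^-1 *: (grad f (x - Q *m grad f x) *m (grad f x)^T)).
Proof.
apply/matrixP => i j; rewrite [in LHS]mxE.
set g := grad f x; set a := f x - f xstar; set y := x - Q *m g.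
(* Moving [Q] along [delta_mx i j] moves [y] on a straight line with velocity
   [- (delta_mx i j *m g)], so the difference quotients coincide and no chain rule is required. *)
have -> : 'D_(delta_mx i j) (Defs.ratio f xstar x) Q =
    'D_(- (delta_mx i j *m g)) (a^-1 \*: (f - cst (f xstar))) y.
  rewrite /derive; apply: (congr1 (fun q : R -> R => lim (q @ 0^'))).
  apply/funext => h /=; congr (_ *: _).
  rewrite /Defs.ratio -/g -/a -/y !fctE /= ![_ / a]mulrC.
  congr (_ * (f _ - _) - _).
  by rewrite mulmxDl -scalemxAl scalerN opprD addrCA.
have f_derivable v : derivable f y v by exact: diff_derivable.
rewrite deriveZ ?deriveB ?derive_cst ?subr0 //; last exact: derivableB.
rewrite derive_dotp_grad dotpNr dotp_mulmx_col !mxE.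
rewrite -scalerN; congr (_ * - _).
rewrite /dotp (bigD1 i) //= [X in _ + X]big1 ?addr0 => [|k ki]; last first.
  by apply: big1 => l _; rewrite [delta_mx _ _ _ _]mxE (negbTE ki) mulr0.
rewrite (bigD1 j) //= [X in _ + X]big1 ?addr0 => [|l lj]; last first.
  by rewrite [delta_mx _ _ _ _]mxE (negbTE lj) andbF mulr0.
by rewrite [delta_mx _ _ _ _]mxE !eqxx mulr1 !mxE.
Qed.

Lemma ratio_continuous x : continuous (Defs.ratio f xstar x).
Proof.
move=> Q.
have inner : {for Q, continuous (fun S : 'M[R]_n => x - S *m grad f x)}.
  by apply: continuousB; [exact: cst_continuous | exact: mulmxl_continuous].
have outer := continuous_comp inner
  (differentiable_continuous (f_differentiable _)).
exact: (cvgMr_tmp (cvgB outer (cvg_cst _))).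
Qed.

Lemma avg_ratio_continuous K (x : nat -> 'cV[R]_n) :
  continuous (avg_ratio f xstar K x).
Proof.
have sum_continuous :
    continuous (fun Q => \sum_(1 <= k < K.+1) Defs.ratio f xstar (x k) Q).
  apply: continuous_big => [|k _]; first exact: add_continuous.
  exact: ratio_continuous.
by move=> Q; exact: (cvgMl_tmp (sum_continuous Q)).
Qed.

(** Extreme value theorem on a compact set; this is what makes the minimum [theta] of the theorem
    exist. *)
Lemma avg_ratio_has_min K (x : nat -> 'cV[R]_n) (S : set 'M[R]_n) (c : R) :
  S !=set0 -> closed S -> (forall Q, S Q -> fnorm Q <= c) ->
  exists theta, is_min [set avg_ratio f xstar K x Q | Q in S] theta.
Proof.
move=> S0 S_closed S_bounded.
have [Q /set_mem SQ Q_min] := compact_EVT_min S0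
  (matrix_bounded_closed_compact S_bounded S_closed)
  (continuous_subspaceT (@avg_ratio_continuous K x)).
exists (avg_ratio f xstar K x Q); split; first by exists Q.
by move=> _ [Q' SQ' <-]; apply: Q_min; exact: mem_set.
Qed.

(** * Consequences of smoothness *)

Section Smooth.
Context (L : R).
Hypotheses (f_smooth : smooth L f) (xstar_min : is_minimizer f xstar).

Lemma smooth_dotp_le x y :
  f x <= f y + dotp (grad f y) (x - y) + L / 2 * dotp (x - y) (x - y).
Proof.
have := f_smooth x y; rewrite fnorm_sqr => /(le_trans (ler_norm _)); lra.
Qed.

Lemma smooth_step_le x v :
  f (x - v) <= f x - dotp (grad f x) v + L / 2 * dotp v v.
Proof.
have := smooth_dotp_le (x - v) x.
by rewrite (_ : x - v - x = - v) ?dotpNr ?dotpNl ?opprK // addrAC subrr add0r.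
Qed.

(** The step [L^-1 *: grad f x] minimizes the quadratic upper bound and lowers it by [G / (2 * L)],
    yet [f] cannot fall below [f xstar]. *)
Lemma dotp_grad_le x : 0 < L ->
  dotp (grad f x) (grad f x) <= 2 * L * (f x - f xstar).
Proof.
move=> L_gt0; have := smooth_step_le x (L^-1 *: grad f x).
have := xstar_min (x - L^-1 *: grad f x).
rewrite !dotpZr !dotpZl.
set G := dotp _ _ => h1 h2.
have : f xstar <= f x - G / (2 * L).
  apply: (le_trans h1); apply: (le_trans h2); rewrite le_eqVlt.
  by apply/orP; left; apply/eqP; field; rewrite gt_eqF.
rewrite lerBrDr -lerBrDl ler_pdivrMr; nra.
Qed.

(** If [L <= 0], the strongly convex lower bound and the smooth upper bound between [x] and [xstar]
    force [x - xstar] to have zero norm, so [x] would be a minimizer. *)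
Lemma smooth_constant_gt0 mu x : 0 < mu -> strongly_convex mu f ->
  ~ is_minimizer f x -> 0 < L.
Proof.
move=> mu_gt0 f_sconvex x_nonmin; rewrite ltNge; apply/negP => L_le0.
apply: x_nonmin => y; apply: le_trans (xstar_min y).
have := f_sconvex x xstar; have := smooth_dotp_le x xstar.
rewrite fnorm_sqr; set d := x - xstar; have d_ge0 := dotp_ge0 d.
move=> up low; have d0 : dotp d d = 0.
  by apply/eqP; rewrite eq_le d_ge0 andbT; nra.
have := norm_dotp_le (grad f xstar) d.
rewrite {2}/fnorm d0 sqrtr0 mulr0 normr_le0 => /eqP gd0.
by move: up; rewrite gd0 d0; lra.
Qed.

Lemma dotp_grad_ratio_le x Q : 0 < L -> f xstar < f x ->
  dotp (grad (Defs.ratio f xstar x) Q) (grad (Defs.ratio f xstar x) Q)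
    <= 4 * L ^+ 2 * Defs.ratio f xstar x Q.
Proof.
move=> L_gt0 fx.
rewrite grad_ratio dotpNr dotpNl opprK dotpZr dotpZl dotp_outer.
rewrite /Defs.ratio; set y := x - _.
have := dotp_grad_le x L_gt0; have := dotp_grad_le y L_gt0.
set a := f x - f xstar; have a_gt0 : 0 < a by rewrite subr_gt0.
set b := f y - f xstar => Gy Gx.
(* The gradient is rank one, so its squared norm is a product of two squared gradients of [f];
   [dotp_grad_le] bounds them at [y] and at [x]. *)
rewrite [leRHS](_ : _ = a^-1 * (a^-1 * ((2 * L * b) * (2 * L * a))));
  last first.
  by field; rewrite gt_eqF.
by rewrite !ler_pM2l ?invr_gt0 // ler_pM ?dotp_ge0.
Qed.

Lemma ratio_le x Q c : 0 < L -> f xstar < f x -> fnorm Q <= c ->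
  Defs.ratio f xstar x Q <= (1 + L * c) ^+ 2.
Proof.
move=> L_gt0 fx Qc; have a_gt0 : 0 < f x - f xstar by rewrite subr_gt0.
rewrite /Defs.ratio ler_pdivrMr //.
have := dotp_grad_le x L_gt0.
set g := grad f x; set a := f x - f xstar in a_gt0 *.
move=> Gx; have c_ge0 := le_trans (fnorm_ge0 Q) Qc.
have := smooth_step_le x (Q *m g); rewrite -/g => up.
have := norm_dotp_mulmx_le g Q g.
rewrite -expr2 fnorm_sqr ler_norml => /andP[low _].
have Qg : dotp (Q *m g) (Q *m g) <= c ^+ 2 * dotp g g.
  rewrite -!fnorm_sqr -exprMn ler_pXn2r ?nnegrE ?mulr_ge0 ?fnorm_ge0 //.
  by apply: le_trans (fnorm_mulmx_le _ _) _; rewrite ler_wpM2r ?fnorm_ge0.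
have lin : dotp g g * fnorm Q <= 2 * L * a * c.
  by rewrite ler_pM ?dotp_ge0 ?fnorm_ge0.
have quad : c ^+ 2 * dotp g g <= c ^+ 2 * (2 * L * a).
  by rewrite ler_wpM2l ?sqr_ge0.
have : L * dotp (Q *m g) (Q *m g) <= L * (c ^+ 2 * (2 * L * a)).
  by rewrite ler_pM2l // (le_trans Qg).
(* The summands match the zeroth, first and second order terms of the smoothness bound along
   [Q *m g]. *)
have -> : (1 + L * c) ^+ 2 * a =
  a + 2 * L * a * c + 2^-1 * (L * (c ^+ 2 * (2 * L * a))) by field.
have aE : f x = a + f xstar by rewrite /a subrK.
by clearbody a; lra.
Qed.

End Smooth.

(** The gradient inequality of [f] is pulled back along the affine map sending [Q] to
    [x - Q *m grad f x]; the quadratic term is nonnegative and dropped. *)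
Lemma ratio_convex mu x Q S : 0 < mu -> strongly_convex mu f ->
  f xstar < f x ->
  Defs.ratio f xstar x Q - Defs.ratio f xstar x S
    <= dotp (grad (Defs.ratio f xstar x) Q) (Q - S).
Proof.
move=> mu_gt0 f_sconvex fx; have a_gt0 : 0 < f x - f xstar by rewrite subr_gt0.
rewrite grad_ratio dotpNl dotpZl -dotp_mulmx_col /Defs.ratio.
rewrite -mulrBl mulrC -mulrN.
rewrite ler_pM2l ?invr_gt0 //.
have := f_sconvex (x - S *m grad f x) (x - Q *m grad f x).
rewrite fnorm_sqr; set g := grad f x.
have -> : x - S *m g - (x - Q *m g) = (Q - S) *m g.
  by rewrite opprB addrC addrA subrK mulmxBl.
have : 0 <= mu / 2 * dotp ((Q - S) *m g) ((Q - S) *m g).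
  by rewrite mulr_ge0 ?dotp_ge0 // divr_ge0 // ltW.
lra.
Qed.

End Objective.

(** * AM-GM, regret of projected gradient descent, and the stepsize *)

Lemma AGM_nat {R : realFieldType} (K : nat) (E : nat -> R) :
  (forall k, (1 <= k <= K)%N -> 0 <= E k) ->
  \prod_(1 <= k < K.+1) E k <= (K%:R^-1 * \sum_(1 <= k < K.+1) E k) ^+ K.
Proof.
move=> E_ge0; rewrite !big_add1 /= !big_mkord.
have := (@leif_AGM R 'I_K predT (fun i => E i.+1)).
rewrite card_ord => /(_ _)[|+ _]; first by move=> i _; apply: E_ge0 => /=.
by rewrite mulrC.
Qed.

Section ProjectedGradient.
Context {R : realType} {m n : nat}.

(* Telescoping |P_k - Q|^2: each projected step decreases it by at least
   2 eta (loss gap) - eta^2 |G_k|^2. *)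
Lemma projected_gradient_regret (S : set 'M[R]_(m, n)) (eta M : R) (K : nat)
    (P G : nat -> 'M[R]_(m, n)) (gap : nat -> R) (Q : 'M[R]_(m, n)) :
  convex_set S -> S Q -> 0 <= eta ->
  (forall k, (1 <= k <= K)%N -> is_projection S (P k - eta *: G k) (P k.+1)) ->
  (forall k, (1 <= k <= K)%N -> gap k <= dotp (G k) (P k - Q)) ->
  (forall k, (1 <= k <= K)%N -> dotp (G k) (G k) <= M) ->
  2 * eta * \sum_(1 <= k < K.+1) gap k <=
    dotp (P 1%N - Q) (P 1%N - Q) + eta ^+ 2 * M * K%:R.
Proof.
move=> S_convex SQ eta_ge0 P_proj gap_le G_le.
(* The induction has to carry the final squared distance, discarded only at the end. *)
suff : 2 * eta * (\sum_(1 <= k < K.+1) gap k)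
    + dotp (P K.+1 - Q) (P K.+1 - Q)
    <= dotp (P 1%N - Q) (P 1%N - Q) + eta ^+ 2 * M * K%:R.
  by apply: le_trans; rewrite lerDl dotp_ge0.
elim: K P_proj gap_le G_le => [|K IH] P_proj gap_le G_le.
  by rewrite big_geq // !mulr0 addr0 add0r.
have weaken k : (1 <= k <= K)%N -> (1 <= k <= K.+1)%N.
  by case/andP=> -> /leqW.
have {}IH := IH (fun k hk => P_proj k (weaken k hk))
  (fun k hk => gap_le k (weaken k hk)) (fun k hk => G_le k (weaken k hk)).
have K1 : (1 <= K.+1 <= K.+1)%N by rewrite leqnn.
have step := projection_nonexpansive S_convex (P_proj _ K1) SQ.
rewrite addrAC [X in _ <= X]dotp_sub !dotpZr !dotpZl dotpC in step.
rewrite big_nat_recr //= -natr1.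
have := ler_wpM2l eta_ge0 (gap_le _ K1).
have := ler_wpM2l (sqr_ge0 eta) (G_le _ K1).
rewrite (dotpC (P K.+1 - Q)) in step.
lra.
Qed.

End ProjectedGradient.

(** The entry [e2] of the minimum equalizes the two terms on the left. The variance term is
    controlled by [eta <= e2]; [D ^+ 2] is controlled by the entry of [rho] matching whichever of
    [e1], [e2] is smaller. *)
Lemma stepsize_rho {R : realType} (L D : R) (K : nat) :
  0 < L -> 0 < D -> (0 < K)%N ->
  0 < stepsize L D K /\
  D ^+ 2 + stepsize L D K ^+ 2 * (4 * L ^+ 2 * (1 + L * D) ^+ 2) * K%:R
    <= 2 * stepsize L D K * rho L D K.
Proof.
move=> L_gt0 D_gt0 K_gt0; rewrite /stepsize /rho.
have q_gt0 : 0 < Num.sqrt K%:R :> R by rewrite sqrtr_gt0 ltr0n.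
have KE : K%:R = Num.sqrt K%:R ^+ 2 :> R by rewrite sqr_sqrtr ?ler0n.
set q := Num.sqrt K%:R in q_gt0 KE *; rewrite KE.
have c_gt0 : 0 < 1 + L * D by rewrite addr_gt0 // mulr_gt0.
set c := 1 + L * D in c_gt0 *.
set e1 := 1 / (4 * L ^+ 2); set e2 := D / (2 * L * c * q).
have e1_gt0 : 0 < e1 by rewrite divr_gt0 // mulr_gt0 // exprn_gt0.
have e2_gt0 : 0 < e2 by rewrite divr_gt0 // !mulr_gt0.
have e1E : D ^+ 2 = e1 * (4 * L ^+ 2 * D ^+ 2).
  by rewrite /e1; field; rewrite gt_eqF.
have e2E : e2 * (4 * L ^+ 2 * c ^+ 2) * q ^+ 2 = 2 * L * D * c * q.
  by rewrite /e2; field; rewrite !gt_eqF.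
have e2D : D ^+ 2 = e2 * (2 * L * D * c * q).
  by rewrite /e2; field; rewrite !gt_eqF.
clearbody e1 e2 q c.
set eta := Num.min e1 e2; set r := Num.max _ _.
have eta_gt0 : 0 < eta by rewrite lt_min e1_gt0.
split => //.
have r1 : 8 * L ^+ 2 * D ^+ 2 <= r by rewrite le_max lexx orbT.
have r2 : 4 * L * D * c * q <= r by rewrite le_max lexx.
clearbody r.
have variance : eta ^+ 2 * (4 * L ^+ 2 * c ^+ 2) * q ^+ 2
    <= eta * (2 * L * D * c * q).
  rewrite -e2E expr2 -3!mulrA ler_pM2l // mulrA.
  rewrite ler_pM2r ?exprn_gt0 // ler_pM2r ?mulr_gt0 ?exprn_gt0 //.
  by rewrite ge_min lexx orbT.
have initial : D ^+ 2 <= eta * (r / 2).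
  have [e12|e21] := leP e1 e2.
    have -> : eta = e1 by exact: min_l.
    by rewrite e1E ler_pM2l //; lra.
  have -> : eta = e2 by exact/min_r/ltW.
  by rewrite e2D ler_pM2l //; lra.
have : eta * (2 * L * D * c * q) <= eta * (r / 2) by rewrite ler_pM2l //; lra.
have r_ge0 : 0 <= r.
  apply: le_trans r1.
  exact: mulr_ge0 (mulr_ge0 (ler0n _ 8) (sqr_ge0 L)) (sqr_ge0 D).
have : 0 <= eta * r by rewrite mulr_ge0 // ltW.
lra.
Qed.

(** * Convergence of OSGM-R from the regret bound *)

Theorem theorem4p1 (R : realType) (n : nat) (f : 'cV[R]_n -> R)
    (L mu D : R) (xstar : 'cV[R]_n) (calP : set 'M[R]_n) (K : nat)
    (x : nat -> 'cV[R]_n) (P : nat -> 'M[R]_n)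
    (f_diff2 : twice_differentiable f)
    (f_smooth : smooth L f)
    (mu_gt0 : 0 < mu)
    (f_sconvex : strongly_convex mu f)
    (xstar_min : is_minimizer f xstar)
    (calP_closed : closed calP)
    (calP_convex : convex_set calP)
    (calP_0 : calP 0)
    (calP_Linv : calP (L^-1)%:M)
    (D_gt0 : 0 < D)
    (calP_diam : (diam calP <= D%:E)%E)
    (K_ge1 : (1 <= K)%N)
    (P1_in : calP (P 1%N))
    (x_osgm : osgm_r f xstar calP (stepsize L D K) K x P)
    (x_nonmin : forall k, (1 <= k <= K)%N -> ~ is_minimizer f (x k)) :
  exists theta : R,
    is_min [set avg_ratio f xstar K x Q | Q in calP] theta /\
    f (x K.+1) - f xstar <=
      (f (x 1%N) - f xstar) * (theta + rho L D K / K%:R) ^+ K.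
Proof.
have x1_nonmin : ~ is_minimizer f (x 1%N) by exact: x_nonmin.
have f_diff : forall y, differentiable f y := f_diff2.1.
have L_gt0 := smooth_constant_gt0 f_smooth xstar_min mu_gt0 f_sconvex x1_nonmin.
have gap_gt0 k : (1 <= k <= K)%N -> f xstar < f (x k).
  move=> hk; rewrite lt_neqAle xstar_min andbT; apply/eqP => fx.
  by apply: (x_nonmin k hk) => y; rewrite -fx; exact: xstar_min.
have P_in k : (1 <= k <= K)%N -> calP (P k).
  case: k => // -[//|k] /= hk.
  have k_le : (1 <= k.+1 <= K)%N by rewrite /= ltnW.
  by have [_ []] := x_osgm k.+1 k_le.
(* Since 0 is feasible, the diameter bound is also a norm bound. *)
have calP_le Q : calP Q -> fnorm Q <= D.
  by move=> PQ; rewrite -[Q]subr0; exact: diam_ge calP_diam PQ calP_0.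
pose r k := Defs.ratio f xstar (x k).
have r_ge0 k Q : (1 <= k <= K)%N -> 0 <= r k Q.
  by move=> /gap_gt0/ltW fx; rewrite divr_ge0 ?subr_ge0.
(* The minimizer [Q] serves as the fixed competitor in the regret. *)
have [theta [[Q PQ theta_Q] theta_min]] := avg_ratio_has_min
  xstar f_diff K x (ex_intro _ 0 calP_0) calP_closed calP_le.
exists theta; split; first by split => //; exists Q.
have [eta_gt0 eta_rho] := stepsize_rho L_gt0 D_gt0 K_ge1.
have K_gt0 : 0 < K%:R :> R by rewrite ltr0n.
have regret : \sum_(1 <= k < K.+1) (r k (P k) - r k Q) <= rho L D K.
  rewrite -(@ler_pM2l _ (2 * stepsize L D K)) ?mulr_gt0 //.
  apply: le_trans eta_rho.
  apply: (le_trans (@projected_gradient_regret _ _ _ calP (stepsize L D K)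
    (4 * L ^+ 2 * (1 + L * D) ^+ 2) K P
    (fun k => grad (r k) (P k)) _ Q calP_convex PQ (ltW eta_gt0) _ _ _)).
  - by move=> k /x_osgm[].
  - move=> k /gap_gt0 fx; exact: (ratio_convex f_diff _ _ mu_gt0 f_sconvex fx).
  - move=> k hk; apply: le_trans
      (dotp_grad_ratio_le f_diff f_smooth xstar_min _ L_gt0 (gap_gt0 k hk)) _.
    rewrite ler_pM2l ?mulr_gt0 ?exprn_gt0 //.
    apply: (ratio_le f_smooth xstar_min L_gt0 (gap_gt0 k hk)).
    exact/calP_le/P_in.
  rewrite lerD2r -fnorm_sqr ler_pXn2r ?nnegrE ?fnorm_ge0 ?(ltW D_gt0) //.
  exact: diam_ge calP_diam P1_in PQ.
have avg_le : K%:R^-1 * \sum_(1 <= k < K.+1) r k (P k)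
    <= theta + rho L D K / K%:R.
  rewrite -theta_Q /avg_ratio [rho _ _ _ / _]mulrC -mulrDr.
  rewrite ler_pM2l ?invr_gt0 //.
  by rewrite -lerBlDl -sumrB.
(* Only gaps at indices 1 to [K] are divided by, so [x K.+1] may be a minimizer. *)
have product j : (j <= K)%N -> f (x j.+1) - f xstar =
    (f (x 1%N) - f xstar) * \prod_(1 <= k < j.+1) r k (P k).
  elim: j => [|j IH] hj; first by rewrite big_geq ?mulr1.
  rewrite big_nat_recr //= mulrA -IH ?(ltnW hj) // /r /Defs.ratio.
  have j_le : (1 <= j.+1 <= K)%N by [].
  have [<- _] := x_osgm j.+1 j_le.
  by rewrite mulrC divfK // subr_eq0 gt_eqF ?gap_gt0.
rewrite product // ler_pM2l ?subr_gt0 ?gap_gt0 //.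
apply: (le_trans (AGM_nat (fun k hk => r_ge0 k (P k) hk))).
(* Raising [avg_le] to the power [K] requires nonnegative bases. *)
have avg_ge0 : 0 <= K%:R^-1 * \sum_(1 <= k < K.+1) r k (P k).
  rewrite mulr_ge0 ?invr_ge0 ?ler0n // big_nat_cond sumr_ge0 // => k.
  by rewrite andbT => /r_ge0.
by rewrite lerXn2r ?nnegrE // (le_trans avg_ge0).
Qed.
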